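(* Let $n\in\mathbb{N}$. The maximal subgroups of $M_n(\mathbb{FT})$ are, up to isomorphism, exactly the groups of the form $\mathbb{R}\times G$ where $G$ is a finite group with a 2-closed permutation representation on $n$ points.
   Context: $\mathbb{FT}=\mathbb{R}$ is the finitary tropical semiring, with $\oplus=\max$ and $\otimes=+$. $M_n(\mathbb{FT})$ is the semigroup of $n\times n$ matrices over $\mathbb{FT}$ under tropical matrix multiplication. A maximal subgroup of a semigroup is a subsemigroup that is a group (its identity being any idempotent of the semigroup) and is maximal among such under inclusion; equivalently, an $\mathcal{H}$-class containing an idempotent. In $\mathbb{R}\times G$, $\mathbb{R}$ denotes the additive group of real numbers. A permutation group $G\le\mathcal{S}_n$ (the symmetric group on $n$ points) is 2-closed if $G$ contains every element of $\mathcal{S}_n$ which preserves each $G$-orbit of ordered pairs of points; a group has a 2-closed permutation representation on $n$ points if it is isomorphic to a 2-closed subgroup of $\mathcal{S}_n$. *)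

(* Defs.v *)
From HB Require Import structures.
From mathcomp Require Import all_boot all_order all_fingroup all_algebra all_solvable.
From mathcomp Require Import boolp classical_sets functions reals.

Set Implicit Arguments.
Unset Strict Implicit.
Unset Printing Implicit Defensive.

Import Order.TTheory GRing.Theory Num.Theory.

Local Open Scope ring_scope.

(* Matrices over the finitary tropical semiring FT = R (max for addition, + for
   multiplication).  This is an alias of 'M[R]_n.+1, so that the semigroup law
   declared below is kept apart from the ordinary matrix product.  FT has no
   additive neutral element, hence the dimension is positive. *)
Definition tropmx (R : realType) (n : nat) : Type := 'M[R]_n.+1.

HB.instance Definition _ (R : realType) (n : nat) :=
  Choice.copy (tropmx R n) 'M[R]_n.+1.

Section TropicalProduct.
Variables (R : realType) (n : nat).
Implicit Types A B C : tropmx R n.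

(* (A * B)_ij = max_k (A_ik + B_kj).  The default value of the iterated max is
   the term k = 0, one of the terms of the nonempty range. *)
Definition tropmul A B : tropmx R n :=
  \matrix_(i, j)
    \big[Num.max/A i ord0 + B ord0 j]_(k < n.+1) (A i k + B k j).

Lemma tropmul_leP A B i j c :
  reflect (forall k, A i k + B k j <= c) (tropmul A B i j <= c).
Proof.
rewrite mxE; apply: (iffP (bigmax_leP _ _ _ _)) => [[_ le_c] k|le_c]; first exact: le_c.
by split=> [|k _]; apply: le_c.
Qed.

Lemma tropmulA : associative tropmul.
Proof.
move=> A B C; apply/matrixP => i j; apply/eqP; rewrite eq_le; apply/andP; split.
- apply/tropmul_leP => k; rewrite -lerBrDl; apply/tropmul_leP => l.
  rewrite lerBrDl addrA.
  have /tropmul_leP/(_ l) := lexx (tropmul (tropmul A B) C i j).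
  by apply: le_trans; rewrite lerD2r; have /tropmul_leP/(_ k) := lexx (tropmul A B i l).
- apply/tropmul_leP => k; rewrite -lerBrDr; apply/tropmul_leP => l.
  rewrite lerBrDr -addrA.
  have /tropmul_leP/(_ l) := lexx (tropmul A (tropmul B C) i j).
  by apply: le_trans; rewrite lerD2l; have /tropmul_leP/(_ k) := lexx (tropmul B C l j).
Qed.

HB.instance Definition _ := hasMul.Build (tropmx R n) tropmul.
HB.instance Definition _ := Magma_isSemigroup.Build (tropmx R n) tropmulA.

End TropicalProduct.

Section MaximalSubgroups.
Local Open Scope group_scope.
Local Open Scope classical_set_scope.

Definition is_subgroup (S : semigroupType) (H : set S) : Prop :=
  (forall x y, H x -> H y -> H (x * y)) /\
  exists e, [/\ H e,
    forall x, H x -> e * x = x /\ x * e = x &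
    forall x, H x -> exists y, [/\ H y, y * x = e & x * y = e]].

Definition maximal_subgroup (S : semigroupType) (H : set S) : Prop :=
  is_subgroup H /\ forall K : set S, is_subgroup K -> H `<=` K -> K = H.

Definition isomorphic_to (S : semigroupType) (H : set S) (K : groupType) : Prop :=
  exists f : S -> K,
    set_bij H setT f /\ forall x y, H x -> H y -> f (x * y) = f x * f y.

End MaximalSubgroups.

Section TwoClosed.
Local Open Scope group_scope.

(* The orbits of G on ordered pairs of points (repeated entries allowed) are
   its orbits for the diagonal action 'P * 2 on 2-tuples. *)
Definition two_closed (T : finType) (G : {group {perm T}}) : Prop :=
  forall s : {perm T},
    (forall t : 2.-tuple T, s \in 'N(orbit ('P * 2) G t | 'P * 2)) -> s \in G.

Definition has_two_closed_rep (n : nat) (gT : finGroupType) : Prop :=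
  exists2 P : {group 'S_n}, two_closed P & [set: gT]%SET \isog P.

End TwoClosed.

(* Main.v *)
Require Import Defs.
From mathcomp Require Import all_boot all_order all_fingroup all_algebra.
From mathcomp Require Import all_solvable.
From mathcomp Require Import boolp classical_sets reals lra zify.

Set Implicit Arguments.
Unset Strict Implicit.
Unset Printing Implicit Defensive.

Import Order.TTheory GRing.Theory Num.Theory.

(** In any semigroup the maximal subgroups are the unit groups of the local
    monoids eSe, with e idempotent, so the task is to compute the units of
    the tropical monoid E S E for an idempotent matrix E.

    Idempotency says that E i k + E k j <= E i j, with equality for some k.
    Following such equalities through finitely many indices produces a cycle
    of weight 0, so k can always be taken critical, that is, E k k = 0.
    Critical indices k and l with E k l + E l k = 0 are interchangeable up to
    an additive constant, so one representative per class is enough; call T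
    the set of representatives.  If A B = B A = E in this monoid, each i in T
    has a partner k in T with A i k + B k i = 0, and the inequalities
    expressing EA = AE = A and AB = BA = E then force row i of A to be row k
    of E plus a constant, and column k of A to be column i of E plus the same
    constant.  So A is given by a permutation s of T and constants a i with
    E (s i) (s j) = E i j + a j - a i.

    The constants are found by averaging this relation over j in T:
    if c i is the mean of row i of E over T, then a i = a0 + c i - c (s i) for
    a single real a0, and the condition on s becomes that it preserves the
    balanced matrix E i j - c i + c j.  Hence the unit group is the direct
    product of R and the group of those s ([crit_unit], [crit_unitM],
    [crit_unit_inj], [unit_group_crit_unit]).  The symmetry group of a matrix
    is 2-closed, and stays so when the points outside T are added as fixed
    points ([crit_syms_two_closed]).

    Conversely, a 2-closed group P on n + 1 points is the symmetry group of a
    matrix whose entries are a distinct negative real for each orbit of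
    ordered pairs of distinct points, and 0 on the diagonal.  If these
    values lie in an interval [-2C, -C[, the matrix is idempotent with
    T everything.  A symmetry of the balanced matrix preserves the sums
    E i j + E j i; with values -(C + 2^m) those sums remember the unordered
    pair formed by an orbit and its opposite.  With at least three points this
    forces the symmetry to preserve each P-orbit of points, hence the row
    means c, hence E itself, hence every orbit of pairs, so it lies in P.
    When T has exactly two points, the balanced matrix is always invariant
    under the swap; so on two points the trivial group comes instead from the
    zero matrix, for which T is a single point. *)

(** * Maximal subgroups as groups of units *)

Section UnitGroup.
Variable S : semigroupType.
Local Open Scope group_scope.
Local Open Scope classical_set_scope.
Implicit Types (e x y : S) (H K : set S).

(** The units of the monoid eSe when e is idempotent. *)
Definition unit_group e : set S :=
  [set x | exists y, [/\ e * x = x, x * e = x, e * y = y, y * e = y &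
                         x * y = e /\ y * x = e]].

Lemma unit_group_subgroup e : e * e = e -> is_subgroup (unit_group e).
Proof.
move=> ee; split=> [x y|].
  move=> [x' [ex xe ex' xe' [xx' x'x]]] [y' [ey ye ey' ye' [yy' y'y]]].
  exists (y' * x'); split; rewrite ?mulgA ?ex ?ey' // -?mulgA ?ye ?xe' //.
  by split; [rewrite (mulgA y) yy' ex' | rewrite (mulgA x') x'x ey].
exists e; split=> [|x [y []] //|x [y [ex xe ey ye [xy yx]]]].
  by exists e.
by exists y; split=> //; exists x.
Qed.

Lemma subgroup_sub_unit_group H e :
  (forall x y, H x -> H y -> H (x * y)) -> H e ->
  (forall x, H x -> e * x = x /\ x * e = x) ->
  (forall x, H x -> exists y, [/\ H y, y * x = e & x * y = e]) ->
  H `<=` unit_group e.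
Proof.
move=> Hmul He He1 Hinv x Hx; have [y [Hy yx xy]] := Hinv x Hx.
have [ex xe] := He1 x Hx; have [ey ye] := He1 y Hy.
by exists y.
Qed.

Lemma unit_group_maximal e : e * e = e -> maximal_subgroup (unit_group e).
Proof.
move=> ee; split=> [|K [Kmul [f [Kf Kf1 Kinv]]] eK].
  exact: unit_group_subgroup.
have Ke : K e by apply: eK; exists e.
have fe : f = e.
  have [y [Ky ye ey]] := Kinv e Ke.
  by rewrite -ye -[in LHS]ee mulgA ye; have [] := Kf1 e Ke.
by apply/seteqP; split=> //; apply: subgroup_sub_unit_group => //; rewrite -fe.
Qed.

Lemma maximal_subgroupE H :
  maximal_subgroup H -> exists2 e, e * e = e & H = unit_group e.
Proof.
move=> [[Hmul [e [He He1 Hinv]]] Hmax].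
have ee : e * e = e by have [] := He1 e He.
exists e => //; apply/esym/Hmax; first exact: unit_group_subgroup.
exact: subgroup_sub_unit_group.
Qed.

End UnitGroup.

(** An isomorphism onto the group K is obtained from a parametrization of H
    by K, the direction in which the units of a matrix monoid are described. *)
Lemma isomorphic_to_param (S : semigroupType) (H : set S) (K : groupType)
    (h : K -> S) :
    (forall x y, h (x * y) = h x * h y)%g -> injective h ->
    (forall A, H A <-> exists x, A = h x) ->
  isomorphic_to H K.
Proof.
move=> hM h_inj hH; pose f A := xget 1%g [set x | A = h x]%classic.
have fK A : H A -> A = h (f A) by move=> /hH; apply: xgetPex.
have hK x : f (h x) = x by apply/h_inj/esym/fK/hH; exists x.
exists f; split; last first.
  by move=> A B /fK hA /fK hB; rewrite {1}hA {1}hB -hM hK.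
split=> [//|A B|x _]; last by exists (h x) => //; apply/hH; exists x.
by rewrite !inE => /fK hA /fK hB eq_f; rewrite hA hB eq_f.
Qed.

(** * Critical indices of an idempotent matrix *)

Section Critical.
Variables (R : realType) (n : nat).
Local Open Scope ring_scope.
Implicit Types (A B C E : tropmx R n) (i j k l : 'I_n.+1).

Lemma tropmulP A B C :
  (A * B)%g = C <-> forall i j, (forall k, A i k + B k j <= C i j) /\
                            exists k, C i j <= A i k + B k j.
Proof.
split=> [<- i j|ABC].
  split; first exact/tropmul_leP.
  have [/existsP //|/existsPn lt_AB] :=
    boolP [exists k, (A * B)%g i j <= A i k + B k j].
  suff : (A * B)%g i j < (A * B)%g i j by rewrite ltxx.
  by rewrite [ltLHS]mxE; apply/bigmax_ltP; split=> [|k _]; rewrite ltNge lt_AB.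
apply/matrixP => i j; apply/eqP; rewrite eq_le.
have [le_AB [k leC]] := ABC i j; apply/andP; split; first exact/tropmul_leP.
by apply: le_trans leC _; have /tropmul_leP := lexx ((A * B)%g i j).
Qed.

Lemma le_tropmul A B C i j k : (A * B)%g = C -> A i k + B k j <= C i j.
Proof. by move/tropmulP/(_ i j) => []. Qed.

Lemma tropmul_attained A B C i j :
  (A * B)%g = C -> exists k, C i j <= A i k + B k j.
Proof. by move/tropmulP/(_ i j) => []. Qed.

Variable E : tropmx R n.
Hypothesis EE : (E * E)%g = E.

Lemma idem_le k i j : E i k + E k j <= E i j.
Proof. exact: le_tropmul. Qed.

Lemma idem_diag_le0 k : E k k <= 0.
Proof. by have := idem_le k k k; lra. Qed.

(** Write k -> l when E k j <= E k l + E l j.  Every k has a successor and the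
    relation is transitive, so on a finite set it has a reflexive point, and
    l -> l says that l is critical.  To keep E i j reached through l, take k
    with fewest successors among the indices reaching E i j: the successors
    of any successor l of k are then those of k, so l -> l. *)
Lemma idem_critical i j : exists2 k, 0 <= E k k & E i j <= E i k + E k j.
Proof.
pose succ k := [set l | E k j <= E k l + E l j].
have [k0 ik0] := tropmul_attained i j EE.
pose reaches k := E i j <= E i k + E k j.
case: (arg_minnP (P := reaches) (fun k => #|succ k|) ik0); rewrite /reaches.
move=> k ik min_k; have [l kl] := tropmul_attained k j EE.
have il : E i j <= E i l + E l j by have := idem_le k i l; lra.
have sub_lk : succ l \subset succ k.
  apply/fintype.subsetP => m; rewrite !inE => lm.
  by have := idem_le l k m; lra.
have /setP/(_ l) : succ l = succ k.
  by apply/eqP; rewrite eqEcard sub_lk min_k.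
by rewrite !inE kl => ll; exists l => //; lra.
Qed.

(** Two critical indices are equivalent when the weight of the 2-cycle through
    them is 0; the least element of each class is kept.  The inequalities
    stand for equalities, as every cycle has weight at most 0. *)
Definition crit_reps : {set 'I_n.+1} :=
  [set k | (0 <= E k k) &&
           [forall l : 'I_n.+1, (0 <= E k l + E l k) ==> (k <= l)%N]].

Lemma crit_reps_diag k : k \in crit_reps -> E k k = 0.
Proof.
rewrite inE => /andP[kk _]; apply/eqP.
by rewrite eq_le kk idem_diag_le0.
Qed.

Lemma crit_reps_inj k l :
  k \in crit_reps -> l \in crit_reps -> 0 <= E k l + E l k -> k = l.
Proof.
rewrite !inE => /andP[_ /forallP/(_ l)/implyP le_kl].
move=> /andP[_ /forallP/(_ k)/implyP le_lk] kl.
apply/val_inj/eqP; rewrite eqn_leq le_kl //= le_lk //.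
by rewrite addrC.
Qed.

Lemma idem_crit_reps i j :
  exists2 k, k \in crit_reps & E i j <= E i k + E k j.
Proof.
have [k kk ik] := idem_critical i j.
have k_k : 0 <= E k k + E k k by lra.
case: (arg_minnP (P := fun l => 0 <= E k l + E l k) val k_k).
move=> t kt min_t; exists t; last first.
  have := idem_le k i t; have := idem_le k t j; lra.
rewrite inE; apply/andP; split; first by have := idem_le k t t; lra.
apply/forallP => l; apply/implyP => tl; apply: min_t.
have := idem_le t k l; have := idem_le t l k; lra.
Qed.

Lemma crit_reps_gt0 : (0 < #|crit_reps|)%N.
Proof.
by have [k kT _] := idem_crit_reps ord0 ord0; apply/card_gt0P; exists k.
Qed.

(** * The units of the local monoid of an idempotent *)

Definition crit_mean i : R :=
  (\sum_(j in crit_reps) E i j) / #|crit_reps|%:R.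
Local Notation c := crit_mean.

(** The conjugate of E by a diagonal matrix whose rows have a common mean over
    [crit_reps].  It does not change when E i j is replaced by
    E i j + a j - a i. *)
Definition balanced i j : R := E i j - c i + c j.

(** Permutations of all indices rather than of the representatives: the other
    indices are fixed, which gives a permutation group on n + 1 points
    whatever the number of representatives is. *)
Definition crit_syms : {set 'S_n.+1} :=
  [set s : 'S_n.+1 | [forall i, if i \in crit_reps
     then [forall (j | j \in crit_reps), balanced (s i) (s j) == balanced i j]
     else s i == i]].

Lemma crit_symsP (s : 'S_n.+1) :
  reflect ((forall i, i \notin crit_reps -> s i = i) /\
           {in crit_reps &, forall i j, balanced (s i) (s j) = balanced i j})
          (s \in crit_syms).
Proof.
rewrite inE; apply: (iffP forallP) => [syms|[s_fix s_bal] i].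
  split=> [i /negPf iT|i j iT jT]; first by have := syms i; rewrite iT => /eqP.
  by have := syms i; rewrite iT => /forall_inP/(_ j jT)/eqP.
case: ifPn => [iT|/s_fix/eqP//].
by apply/forall_inP => j jT; rewrite s_bal.
Qed.

Lemma crit_syms_reps s i :
  s \in crit_syms -> i \in crit_reps -> s i \in crit_reps.
Proof.
move=> /crit_symsP[s_fix _] iT; have [//|siT] := boolP (s i \in crit_reps).
by have := iT; rewrite -(perm_inj (s_fix _ siT)) (negPf siT).
Qed.

Lemma crit_syms_group_set : group_set crit_syms.
Proof.
apply/group_setP; split=> [|s t Gs Gt].
  by apply/crit_symsP; split=> [i _|i j _ _]; rewrite !perm1.
have [[s_fix s_bal] [t_fix t_bal]] := (crit_symsP _ Gs, crit_symsP _ Gt).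
apply/crit_symsP; split=> [i iT|i j iT jT].
  by rewrite permM s_fix // t_fix.
by rewrite !permM t_bal ?s_bal // crit_syms_reps.
Qed.
Canonical crit_syms_group := Group crit_syms_group_set.

Lemma crit_syms_idem s i j : s \in crit_syms -> i \in crit_reps ->
  j \in crit_reps -> E (s i) (s j) = E i j - c i + c (s i) + c j - c (s j).
Proof.
by move=> /crit_symsP[_ /[apply] /[apply]]; rewrite /balanced; lra.
Qed.

Definition crit_term (a : R) (s : 'S_n.+1) i j k : R :=
  E i k + (a + c k - c (s k)) + E (s k) j.

(** The product of E, a monomial matrix carried by the representatives, and
    E, where the missing entries of the monomial matrix count as minus
    infinity. *)
Definition crit_unit (a : R) (s : 'S_n.+1) : tropmx R n :=
  \matrix_(i, j) crit_term a s i j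
    [arg max_(k > odflt ord0 [pick k in crit_reps] | k \in crit_reps)
       crit_term a s i j k]%O.

Lemma crit_unitP a s i j :
  (forall k, k \in crit_reps -> crit_term a s i j k <= crit_unit a s i j) /\
  exists2 k, k \in crit_reps & crit_unit a s i j = crit_term a s i j k.
Proof.
rewrite mxE; case: arg_maxP => [|k kT max_k]; last first.
  by split=> //; exists k.
case: pickP => //= T0; have := crit_reps_gt0.
by rewrite (eq_card0 T0).
Qed.

(** On the row of a representative i, the maximum defining [crit_unit] is
    reached at k = i, because s preserves the balanced matrix. *)
Lemma crit_unit_row a s i j : s \in crit_syms -> i \in crit_reps ->
  crit_unit a s i j = a + c i - c (s i) + E (s i) j.
Proof.
move=> Gs iT; apply/eqP; rewrite eq_le; apply/andP.
have [le_u [k kT eq_u]] := crit_unitP a s i j; split; last first.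
  by apply: le_trans (le_u i iT); rewrite /crit_term crit_reps_diag //; lra.
rewrite eq_u; have := idem_le (s k) (s i) j.
by rewrite crit_syms_idem // /crit_term; lra.
Qed.

Lemma crit_unit1 : crit_unit 0 1%g = E.
Proof.
apply/matrixP => i j; apply/eqP; rewrite eq_le.
have [le_u [k kT eq_u]] := crit_unitP 0 1%g i j; apply/andP; split.
  by rewrite eq_u /crit_term perm1; have := idem_le k i j; lra.
have [l lT le_l] := idem_crit_reps i j.
by apply: le_trans le_l _; have := le_u l lT; rewrite /crit_term perm1; lra.
Qed.

Lemma crit_unitM a b s t : s \in crit_syms -> t \in crit_syms ->
  (crit_unit a s * crit_unit b t)%g = crit_unit (a + b) (s * t)%g.
Proof.
move=> Gs Gt; apply/tropmulP => i j.
have [le_st [k kT eq_st]] := crit_unitP (a + b) (s * t)%g i j.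
have sT := crit_syms_reps Gs; split=> [m|].
  have [_ [p pT ->]] := crit_unitP a s i m.
  have [_ [q qT ->]] := crit_unitP b t m j.
  (* The two middle factors combine to E (s p) q, which t carries to
     E (t (s p)) (t q) up to the constants c. *)
  have := le_st p pT; rewrite /crit_term permM.
  have := idem_le m (s p) q; have := idem_le (t q) (t (s p)) j.
  by rewrite (crit_syms_idem Gt) ?sT //; lra.
exists (s k); rewrite eq_st (crit_unit_row b j Gt (sT k kT)).
have [/(_ k kT) + _] := crit_unitP a s i (s k).
by rewrite /crit_term (crit_reps_diag (sT k kT)) permM; lra.
Qed.

(** The rows of distinct representatives are not translates of one another, so
    the rows of a unit determine the permutation. *)
Lemma crit_unit_inj a b s t : s \in crit_syms -> t \in crit_syms ->
  crit_unit a s = crit_unit b t -> a = b /\ s = t.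
Proof.
move=> Gs Gt eq_u.
have row_u i j : i \in crit_reps ->
    a + c i - c (s i) + E (s i) j = b + c i - c (t i) + E (t i) j.
  by move=> iT; rewrite -!crit_unit_row // eq_u.
have st i : i \in crit_reps -> s i = t i.
  move=> iT; have [sT tT] := (crit_syms_reps Gs iT, crit_syms_reps Gt iT).
  apply: crit_reps_inj => //.
  have := row_u i (s i) iT; have := row_u i (t i) iT.
  by rewrite !crit_reps_diag //; lra.
split; last first.
  apply/permP => i; have [/st//|iT] := boolP (i \in crit_reps).
  by have [/crit_symsP[-> // _] /crit_symsP[-> // _]] := (Gs, Gt).
have /card_gt0P[i iT] := crit_reps_gt0.
by have := row_u i i iT; rewrite st //; lra.
Qed.

Lemma crit_unit_in_unit_group a s :
  s \in crit_syms -> unit_group E (crit_unit a s).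
Proof.
move=> Gs; have Gs' : (s^-1)%g \in crit_syms by rewrite groupV.
exists (crit_unit (- a) s^-1%g); rewrite -crit_unit1.
rewrite !crit_unitM ?group1 //.
by rewrite !(mul1g, mulg1, mulgV, mulVg, add0r, addr0, subrr, addNr).
Qed.

(** The i-th diagonal entry 0 of AB = E is reached at some index, and then at
    a representative f i, since A = AE and E factors through [crit_reps]; the
    inequalities for EA, AE, AB and BA are then tight along row i and
    column f i. *)
Lemma unit_group_crit_unit A : unit_group E A ->
  exists a, exists2 s, s \in crit_syms & A = crit_unit a s.
Proof.
move=> [B [EA AE EB BE [AB BA]]].
have match_ex i : exists k, i \in crit_reps ->
    k \in crit_reps /\ 0 <= A i k + B k i.
  have [iT|] := boolP (i \in crit_reps); last by exists i.
  have [l il] := tropmul_attained i i AB.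
  have [p ilp] := tropmul_attained i l AE.
  have [k kT pl] := idem_crit_reps p l.
  exists k => _; split=> //; have := le_tropmul i k p AE.
  have := le_tropmul k i l EB.
  by rewrite crit_reps_diag // in il; lra.
have {match_ex} [f fP] := fin_all_exists match_ex.
pose a i := A i (f i).
have fT i : i \in crit_reps -> f i \in crit_reps by move=> /fP[].
have rowA i j : i \in crit_reps -> A i j = a i + E (f i) j.
  move=> iT; have [_ AB_ge0] := fP i iT; apply/eqP; rewrite eq_le.
  have := le_tropmul i j (f i) AE; have := le_tropmul (f i) j i BA.
  by rewrite /a => *; apply/andP; split; lra.
have colA i l : i \in crit_reps -> A l (f i) = E l i + a i.
  move=> iT; have [_ AB_ge0] := fP i iT; apply/eqP; rewrite eq_le.
  have := le_tropmul l (f i) i EA; have := le_tropmul l i (f i) AB.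
  by rewrite /a => *; apply/andP; split; lra.
have Ef i j : i \in crit_reps -> j \in crit_reps ->
    E (f i) (f j) = E i j + a j - a i.
  by move=> iT jT; have := rowA i (f j) iT; rewrite colA //; lra.
have f_inj : {in crit_reps &, injective f}.
  move=> i j iT jT eq_f; apply: crit_reps_inj => //.
  have := Ef i j iT jT; have := Ef j i jT iT.
  by rewrite eq_f crit_reps_diag ?fT //; lra.
pose g i := if i \in crit_reps then f i else i.
have g_inj : injective g.
  move=> i j; rewrite /g; case: ifPn => iT; case: ifPn => jT // fij.
  - exact: f_inj.
  - by rewrite -fij fT in jT.
  - by rewrite fij fT in iT.
have sE i : i \in crit_reps -> perm g_inj i = f i.
  by move=> iT; rewrite permE /g iT.
(* As f permutes the representatives, the mean of E (f i) (f j) over j is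
   the mean of row f i: this expresses a i through c and one constant. *)
pose a0 := (\sum_(j in crit_reps) a j) / #|crit_reps|%:R.
have imf : f @: crit_reps = crit_reps.
  apply/eqP; rewrite eqEcard card_in_imset // leqnn andbT.
  by apply/fintype.subsetP => _ /imsetP[i iT ->]; apply: fT.
have cf i : i \in crit_reps -> c (f i) = c i + a0 - a i.
  move=> iT; have T_neq0 : #|crit_reps|%:R != 0 :> R.
    by rewrite pnatr_eq0 -lt0n crit_reps_gt0.
  have -> : c (f i) =
      (\sum_(j in crit_reps) (E i j + a j - a i)) / #|crit_reps|%:R.
    rewrite {1}/crit_mean -[in X in X / _]imf big_imset //=.
    by congr (_ / _); apply: eq_bigr => j jT; rewrite Ef.
  rewrite !big_split /= sumr_const !mulrDl -/a0 -/(c i).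
  by congr (_ + _); rewrite -(mulr_natr (- a i)) mulfK.
have Gs : perm g_inj \in crit_syms.
  apply/crit_symsP; split=> [i iT|i j iT jT].
    by rewrite permE /g (negPf iT).
  by rewrite /balanced !sE // Ef // !cf //; lra.
exists a0; exists (perm g_inj) => //.
apply/matrixP => i j; apply/eqP; rewrite eq_le.
have [le_u [k kT eq_u]] := crit_unitP a0 (perm g_inj) i j; apply/andP; split.
  have [l il] := tropmul_attained i j EA.
  have [k' k'T lk'] := idem_crit_reps i l.
  have := le_u k' k'T; have := le_tropmul k' j l EA.
  rewrite /crit_term sE // cf //.
  by rewrite (rowA k' j k'T); lra.
have := le_tropmul i j k EA.
by rewrite eq_u /crit_term sE // cf // (rowA k j kT); lra.
Qed.

End Critical.

(** * Two-closed permutation groups *)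

Section TwoClosedSyms.
Local Open Scope group_scope.

(** A permutation preserves all orbits of pairs exactly when it agrees on each
    pair of points with some element of the group. *)
Lemma two_closedP (T : finType) (G : {group {perm T}}) :
  two_closed G <->
  forall s : {perm T},
    (forall x y, exists2 g : {perm T}, g \in G & s x = g x /\ s y = g y) ->
    s \in G.
Proof.
split=> G2 s sG; apply: G2.
  move=> t; apply/astabsP; case=> [[|x [|y []]] // xy].
  have [g Gg [sx sy]] := sG x y.
  have eq_sg : n_act 'P (Tuple xy) s = n_act 'P (Tuple xy) g.
    by apply: val_inj; rewrite /= /aperm sx sy.
  by rewrite -[RHS](orbit_actr _ _ _ Gg) /= eq_sg.
move=> x y; have := astabs_act [tuple x; y] (sG [tuple x; y]).
rewrite orbit_refl => /imsetP[g Gg /(congr1 val) []].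
by rewrite /= /aperm => sx sy; exists g.
Qed.

End TwoClosedSyms.

(** * The maximal subgroup of an idempotent matrix *)

Section Isomorphism.
Variables (R : realType) (n : nat) (E : tropmx R n).
Hypothesis EE : (E * E)%g = E.

(** Membership is a condition on single points and on pairs of points, so it
    only depends on how a permutation acts on each pair. *)
Lemma crit_syms_two_closed : two_closed (crit_syms_group E).
Proof.
apply/two_closedP => s sG; apply/crit_symsP; split=> [i iT|i j iT jT].
  have [g /crit_symsP[g_fix _] [-> _]] := sG i i.
  exact: g_fix.
by have [g /crit_symsP[_ g_bal] [-> ->]] := sG i j; apply: g_bal.
Qed.

Lemma unit_group_isomorphic (gT : finGroupType) :
  [set: gT] \isog crit_syms E ->
  isomorphic_to (unit_group E) (Algebra.to_multiplicative R * gT)%type.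
Proof.
move=> /isogP[f /injmP f_inj f_im].
have Gf x : f x \in crit_syms E by rewrite -f_im mem_morphim ?inE.
apply: (@isomorphic_to_param _ _ (Algebra.to_multiplicative R * gT)%type
          (fun x => crit_unit E x.1 (f x.2))).
- move=> [a x] [b y] /=; rewrite crit_unitM ?Gf //.
  by rewrite -morphM ?inE.
- move=> [a x] [b y] /= /(crit_unit_inj EE (Gf x) (Gf y))[-> eq_f].
  by rewrite (f_inj x y) ?inE.
- move=> A; split=> [|[x ->]]; last exact: crit_unit_in_unit_group.
  move=> /(unit_group_crit_unit EE)[a [s Gs ->]].
  by move: Gs; rewrite -f_im => /morphimP[x _ _ ->]; exists (a, x).
Qed.

End Isomorphism.

(** * A matrix with a prescribed symmetry group *)

Section OrbitalMatrix.
Variables (R : realType) (n : nat) (P : {group 'S_n.+1}).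
Local Open Scope ring_scope.
Implicit Types (i j : 'I_n.+1) (s g : 'S_n.+1).

Definition orbital i j : {set 'I_n.+1 * 'I_n.+1} :=
  [set (g i, g j) | g : 'S_n.+1 in P].

Lemma orbital_refl i j : (i, j) \in orbital i j.
Proof. by apply/imsetP; exists 1%g; rewrite ?group1 ?perm1. Qed.

Lemma orbital_perm g i j : g \in P -> orbital (g i) (g j) = orbital i j.
Proof.
move=> Pg; apply/setP => -[x y]; apply/imsetP/imsetP => -[h Ph [-> ->]].
  by exists (g * h)%g; rewrite ?groupM // !permM.
by exists (g^-1 * h)%g; rewrite ?groupM ?groupV // !permM !permK.
Qed.

Lemma orbital_eq i j k l : orbital k l = orbital i j ->
  exists2 g, g \in P & k = g i /\ l = g j.
Proof.
move=> eq_o; have := orbital_refl k l; rewrite eq_o => /imsetP[g Pg [-> ->]].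
by exists g.
Qed.

(** Powers of 2, so that the sum of two codes determines them up to order. *)
Definition orbital_code i j : nat := 2 ^ enum_rank (orbital i j).

Definition orbital_bound : nat := 2 ^ #|{set 'I_n.+1 * 'I_n.+1}|.

(** The shift by C = [orbital_bound], an upper bound of the codes, puts the
    off-diagonal entries in [-2C, -C[, so that the sum of two of them is at
    most any third: this makes the matrix idempotent. *)
Definition orbital_mx : tropmx R n := \matrix_(i, j)
  if i == j then 0 else - (orbital_bound + orbital_code i j)%:R.

Lemma orbital_code_bounds i j : (0 < orbital_code i j <= orbital_bound)%N.
Proof.
by rewrite /orbital_code expn_gt0 leq_exp2l ?(ltnW (ltn_ord _)).
Qed.

Lemma orbital_mx_diag i : orbital_mx i i = 0.
Proof. by rewrite mxE eqxx. Qed.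

Lemma orbital_mx_offdiag i j :
  i != j -> orbital_mx i j = - orbital_bound%:R - (orbital_code i j)%:R.
Proof. by move=> /negPf ij; rewrite mxE ij natrD opprD. Qed.

Lemma orbital_mx_bounds i j : i != j ->
  - (orbital_bound%:R *+ 2) <= orbital_mx i j < - orbital_bound%:R.
Proof.
move=> ij; have /andP[] := orbital_code_bounds i j.
rewrite orbital_mx_offdiag // -(ltr_nat R) -(ler_nat R) mulr2n => *.
by apply/andP; split; lra.
Qed.

Lemma orbital_mx_le0 i j : orbital_mx i j <= 0.
Proof.
have [->|/orbital_mx_bounds/andP[_]] := eqVneq i j.
  by rewrite orbital_mx_diag.
by have : (0 : R) <= orbital_bound%:R by []; lra.
Qed.

Lemma orbital_mx_idem : (orbital_mx * orbital_mx)%g = orbital_mx.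
Proof.
apply/tropmulP => i j; split=> [k|]; last first.
  by exists i; rewrite orbital_mx_diag add0r.
have [<-|ik] := eqVneq i k; first by rewrite orbital_mx_diag add0r.
have [->|kj] := eqVneq k j; first by rewrite orbital_mx_diag addr0.
have [<-|ij] := eqVneq i j.
  rewrite orbital_mx_diag.
  by have := orbital_mx_le0 i k; have := orbital_mx_le0 k i; lra.
have /andP[+ _] := orbital_mx_bounds ij.
have /andP[_] := orbital_mx_bounds ik; have /andP[_] := orbital_mx_bounds kj.
by lra.
Qed.

Lemma orbital_mx_reps : crit_reps orbital_mx = [set: 'I_n.+1].
Proof.
apply/setP => i; rewrite !inE orbital_mx_diag lexx /=.
apply/forallP => j; apply/implyP; have [->//|ij] := eqVneq i j.
have /andP[_] := orbital_mx_bounds ij; rewrite eq_sym in ij.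
have /andP[_] := orbital_mx_bounds ij.
by have : (0 : R) <= orbital_bound%:R by []; lra.
Qed.

Lemma orbital_mx_perm g i j :
  g \in P -> orbital_mx (g i) (g j) = orbital_mx i j.
Proof.
by move=> Pg; rewrite !mxE (inj_eq perm_inj) /orbital_code orbital_perm.
Qed.

Lemma orbital_mx_mean g i :
  g \in P -> crit_mean orbital_mx (g i) = crit_mean orbital_mx i.
Proof.
move=> Pg; rewrite /crit_mean; congr (_ / _).
rewrite orbital_mx_reps (reindex_inj (@perm_inj _ g)) /=.
by apply: eq_big => [j|j _]; rewrite ?inE ?orbital_mx_perm.
Qed.

(** The sum of two powers of 2 lies between the larger of them and its
    double, which identifies the larger one. *)
Lemma expn2_sum_inj a b c d :
  (2 ^ a + 2 ^ b = 2 ^ c + 2 ^ d)%N -> (a = c /\ b = d) \/ (a = d /\ b = c).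
Proof.
wlog ab : a b / (a <= b)%N => [th|].
  by have [/th//|/ltnW/th{}th] := leqP a b; rewrite addnC => /th; tauto.
wlog cd : c d / (c <= d)%N => [th|].
  have [/th//|/ltnW/th{}th] := leqP c d.
  by rewrite [(2 ^ c + _)%N]addnC => /th; tauto.
wlog bd : a b c d ab cd / (b <= d)%N => [th|eq_sum].
  have [|/ltnW db eq_sum] := leqP b d; first exact: th.
  by case: (th c d a b) => // -[-> ->]; [left|right].
have [lt_bd|le_db] := ltnP b d.
  have le2b : (2 ^ a + 2 ^ b <= 2 ^ b.+1)%N.
    by rewrite expnS mul2n -addnn leq_add2r leq_exp2l.
  have le2d : (2 ^ b.+1 <= 2 ^ d)%N by rewrite leq_exp2l.
  by have := expn_gt0 2 c; rewrite /=; lia.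
have bE : b = d by lia.
left; split=> //; subst d; move/eqP: eq_sum.
by rewrite eqn_add2r eqn_exp2l // => /eqP.
Qed.

Definition conj_points i j := exists2 g, g \in P & i = g j.

Lemma conj_points_sym i j : conj_points i j -> conj_points j i.
Proof. by move=> [g Pg ->]; exists g^-1%g; rewrite ?groupV ?permK. Qed.

Lemma conj_points_trans j i k :
  conj_points i j -> conj_points j k -> conj_points i k.
Proof.
by move=> [g Pg ->] [h Ph ->]; exists (h * g)%g; rewrite ?groupM ?permM.
Qed.

(** In the sum of two opposite entries the row means cancel, so it is invariant
    under every symmetry; it determines the unordered pair of opposite
    orbitals. *)
Lemma crit_syms_orbital_pair s i j : s \in crit_syms orbital_mx -> i != j ->
  (conj_points (s i) i /\ conj_points (s j) j) \/
  (conj_points (s i) j /\ conj_points (s j) i).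
Proof.
move=> Gs ij; have sij : s i != s j by rewrite (inj_eq perm_inj).
have inT k : k \in crit_reps orbital_mx by rewrite orbital_mx_reps inE.
have : orbital_mx (s i) (s j) + orbital_mx (s j) (s i) =
       orbital_mx i j + orbital_mx j i.
  by rewrite !crit_syms_idem //; lra.
rewrite !orbital_mx_offdiag // 1?eq_sym // => eq_sum.
have : (orbital_code (s i) (s j))%:R + (orbital_code (s j) (s i))%:R =
       (orbital_code i j)%:R + (orbital_code j i)%:R :> R by lra.
rewrite -!natrD => /eqP; rewrite eqr_nat => /eqP /expn2_sum_inj.
case=> -[/ord_inj/enum_rank_inj/orbital_eq[g Pg [-> ->]] _].
  by left; split; exists g.
by right; split; exists g.
Qed.

(** If s i were not conjugate to i, then for every other j both s i and j, and
    s j and i, would be conjugate.  Two such points j and k are then conjugate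
    to each other, so the pair (j, k) gives s j conjugate to j, and the chain
    s i, j, s j, i is a contradiction. *)
Lemma crit_syms_conj_points s i : (1 < n)%N ->
  s \in crit_syms orbital_mx -> conj_points (s i) i.
Proof.
move=> n_gt1 Gs.
have swap j : ~ conj_points (s i) i -> i != j ->
    conj_points (s i) j /\ conj_points (s j) i.
  by move=> ? /(crit_syms_orbital_pair Gs) [[]|].
apply: contrapT => Nsi.
have [j ij [k ik jk]] : exists2 j, i != j & exists2 k, i != k & j != k.
  have /card_gt1P[j [k [ij ik jk]]] : (1 < #|predC1 i|)%N.
    by rewrite cardC1 card_ord.
  by exists j; [rewrite eq_sym|exists k; rewrite // eq_sym].
have [[sij sji] [sik ski]] := (swap j Nsi ij, swap k Nsi ik).
have jk' : conj_points j k := conj_points_trans (conj_points_sym sij) sik.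
have sjj : conj_points (s j) j.
  have [[]//|[sjk _]] := crit_syms_orbital_pair Gs jk.
  exact: conj_points_trans sjk (conj_points_sym jk').
by apply/Nsi/(conj_points_trans sij)/(conj_points_trans _ sji)/conj_points_sym.
Qed.

Lemma sub_crit_syms_orbital : P \subset crit_syms orbital_mx.
Proof.
apply/fintype.subsetP => g Pg; apply/crit_symsP; split=> [i|i j _ _].
  by rewrite orbital_mx_reps inE.
by rewrite /balanced orbital_mx_perm // !orbital_mx_mean.
Qed.

(** Symmetries preserve the orbits of points, hence the row means, so they
    preserve the orbital matrix itself and not only its balanced form. *)
Lemma crit_syms_orbital : (1 < n)%N -> two_closed P ->
  crit_syms orbital_mx = P.
Proof.
move=> n_gt1 /two_closedP P2; apply/eqP; rewrite finset.eqEsubset.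
rewrite sub_crit_syms_orbital andbT; apply/fintype.subsetP => s Gs.
apply: P2 => i j; have [<-|ij] := eqVneq i j.
  by have [g Pg si] := crit_syms_conj_points i n_gt1 Gs; exists g.
have inT k : k \in crit_reps orbital_mx by rewrite orbital_mx_reps inE.
have mean_s k : crit_mean orbital_mx (s k) = crit_mean orbital_mx k.
  by have [g Pg ->] := crit_syms_conj_points k n_gt1 Gs; apply: orbital_mx_mean.
have := crit_syms_idem Gs (inT i) (inT j); rewrite !mean_s.
rewrite !orbital_mx_offdiag ?(inj_eq perm_inj) // => eq_code.
have /eqP : (orbital_code (s i) (s j))%:R = (orbital_code i j)%:R :> R by lra.
by rewrite eqr_nat eqn_exp2l // => /eqP/ord_inj/enum_rank_inj/orbital_eq.
Qed.

End OrbitalMatrix.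

(** * Every two-closed group is realized *)

Section Realization.
Variables (R : realType) (n : nat).

Lemma two_closed_realized (P : {group 'S_n.+1}) : two_closed P ->
  exists2 E : tropmx R n, (E * E)%g = E & crit_syms E = P.
Proof.
move=> P2; have [n_gt1|n_le1] := ltnP 1 n.
  by exists (orbital_mx R P); [exact: orbital_mx_idem|exact: crit_syms_orbital].
(* At most two points: P is trivial or the full symmetric group. *)
have [P1|P_neq1] := eqVneq (P : {set _}) 1%g; last first.
  exists (orbital_mx R P); first exact: orbital_mx_idem.
  have PT : P = [set: 'S_n.+1] :> {set _}.
    apply/eqP; rewrite eqEcard finset.subsetT cardsT card_Sn.
    have fact_le2 : (n.+1`! <= 2)%N by case: n n_le1 => [|[|[]]].
    by apply: leq_trans fact_le2 _; rewrite cardG_gt1.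
  apply/eqP; rewrite finset.eqEsubset sub_crit_syms_orbital andbT.
  by rewrite PT finset.subsetT.
(* All indices are equivalent for the zero matrix. *)
pose E : tropmx R n := (\matrix_(i, j) 0)%R.
have Eij i j : E i j = 0%R by rewrite mxE.
have EE : (E * E)%g = E.
  apply/tropmulP => i j; rewrite !Eij.
  split=> [k|]; first by rewrite !Eij addr0.
  by exists i; rewrite !Eij addr0.
exists E => //; apply/eqP; rewrite P1 finset.eqEsubset sub1G andbT.
apply/fintype.subsetP => s Gs; rewrite inE; apply/eqP/permP => i; rewrite perm1.
have [iT|iT] := boolP (i \in crit_reps E); last by case/crit_symsP: Gs => ->.
by apply: (crit_reps_inj (E := E)); rewrite ?crit_syms_reps ?Eij ?addr0.
Qed.

End Realization.

Theorem corollary7p9 (R : realType) (n : nat) :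
  (forall H : set (tropmx R n), maximal_subgroup H ->
     exists2 gT : finGroupType, has_two_closed_rep n.+1 gT &
       isomorphic_to H (Algebra.to_multiplicative R * gT)%type) /\
  (forall gT : finGroupType, has_two_closed_rep n.+1 gT ->
     exists2 H : set (tropmx R n), maximal_subgroup H &
       isomorphic_to H (Algebra.to_multiplicative R * gT)%type).
Proof.
split=> [H /maximal_subgroupE[E EE ->]|gT [P P2 gTP]].
  have iso : [set: [subg (crit_syms_group E)]] \isog crit_syms E.
    by rewrite isog_sym; exact: isog_subg.
  exists [the finGroupType of subg_of (crit_syms_group E)].
    by exists (crit_syms_group E); [exact: crit_syms_two_closed|exact: iso].
  exact: unit_group_isomorphic.
have [E EE EP] := two_closed_realized R P2.
exists (unit_group E); first exact: unit_group_maximal.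
by apply: unit_group_isomorphic => //; rewrite EP.
Qed.
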